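(* Let $X$ be a Banach function space over $\mathbb{R}$ (with Lebesgue measure) on which the translations $T_k$ are bounded for every $k\in\mathbb{R}$, and suppose that the operators $\{B_s\}_{s>1}$ are uniformly bounded on $X$. Then the truncated Hilbert transform $H_1:X\to X$ is bounded if and only if the segment multiplier $S:X\to X$ is bounded.
   Context: Let $\mathcal{M}(\mathbb{R})$ be the set of Lebesgue measurable scalar-valued functions (real or complex) on $\mathbb{R}$ and $\mathcal{M}^+(\mathbb{R})$ the non-negative ones. A Banach function norm is a map $\rho:\mathcal{M}^+(\mathbb{R})\to[0,\infty]$ such that: (a) $\rho(f)=0$ iff $f=0$ a.e., $\rho(af)=a\rho(f)$ for $a\ge 0$, $\rho(f+g)\le\rho(f)+\rho(g)$; (b) $f\le g$ a.e. implies $\rho(f)\le\rho(g)$; (c) $f_n\nearrow f$ a.e. implies $\rho(f_n)\nearrow\rho(f)$; (d) $|E|<\infty$ implies $\rho(\chi_E)<\infty$; (e) if $|E|<\infty$ there is $C_E>0$ with $\int_E f\le C_E\rho(f)$ for all $f\in\mathcal{M}^+(\mathbb{R})$. The associated Banach function space is $X=\{f\in\mathcal{M}(\mathbb{R}):\rho(|f|)<\infty\}$ with $\|f\|_X=\rho(|f|)$. Operators: $T_kf(x)=f(x-k)$; $B_sf(x)=\frac1{2s}\int_{x-s}^{x+s}f(t)\,dt$ for $s>0$; $Sf(x)=\int_{\mathbb{R}}\frac{\sin(x-y)}{x-y}f(y)\,dy$; $H_1f(x)=\int_{|x-y|\ge1}\frac{f(y)}{x-y}\,dy$. Uniformly bounded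 means there is $C$ independent of $s>1$ with $\|B_s\|_{X\to X}\le C$. An operator $T$ is bounded on $X$ if for every $f\in X$ the function $Tf$ is defined (the integral converges for a.e. $x$) and belongs to $X$, with $\|Tf\|_X\le C\|f\|_X$ for a constant $C$ independent of $f$. *)

(* Defs.v *)
From HB Require Import structures.
From mathcomp Require Import all_boot all_order all_algebra.
From mathcomp Require Import all_classical all_reals all_analysis.
From mathcomp Require Import complex.
Set Implicit Arguments.
Unset Strict Implicit.
Unset Printing Implicit Defensive.
Import Order.TTheory GRing.Theory Num.Theory.
Import numFieldNormedType.Exports.
Import ComplexField.
Local Open Scope classical_set_scope.
Local Open Scope complex_scope.
Local Open Scope ring_scope.

(* The real line with the sigma-algebra of Lebesgue (not just Borel)
   measurable sets; its carrier is convertible to R. *)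
Definition lebT (R : realType) := caratheodory_type ((@wlength R idfun)^*)%mu.

Notation leb R := (@completed_lebesgue_measure R).

Section LebesgueMeasurable.
Variable R : realType.

Definition lmeas_set (E : set R) : Prop := measurable (E : set (lebT R)).

Definition lmeas_fun (f : R -> R) : Prop :=
  measurable_fun [set: lebT R] (f : lebT R -> R).

Definition Mplus (f : R -> R) : Prop := lmeas_fun f /\ forall x, 0 <= f x.

End LebesgueMeasurable.

(* Only the values of rho on Mplus are constrained. *)
Record banach_function_norm (R : realType) (rho : (R -> R) -> \bar R) : Prop :=
  BanachFunctionNorm {
  bfn_ge0 : forall f : R -> R, Mplus f -> (0 <= rho f)%E ;
  bfn_eq0 : forall f : R -> R, Mplus f ->
    (rho f = 0%E <-> {ae leb R, forall x : R, f x = 0}) ;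
  bfn_homo : forall (a : R) (f : R -> R), 0 <= a -> Mplus f ->
    rho (fun x => a * f x) = (a%:E * rho f)%E ;
  bfn_triangle : forall f g : R -> R, Mplus f -> Mplus g ->
    (rho (fun x => f x + g x)%R <= rho f + rho g)%E ;
  bfn_mono : forall f g : R -> R, Mplus f -> Mplus g ->
    {ae leb R, forall x : R, f x <= g x} -> (rho f <= rho g)%E ;
  bfn_fatou : forall (f_ : nat -> R -> R) (f : R -> R),
    (forall n, Mplus (f_ n)) -> Mplus f ->
    {ae leb R, forall x : R, nondecreasing_seq (fun n => f_ n x) /\
                             f_ n x @[n --> \oo] --> f x} ->
    nondecreasing_seq (fun n => rho (f_ n)) /\
    rho (f_ n) @[n --> \oo] --> rho f ;
  bfn_indic : forall E : set R, lmeas_set E -> (leb R E < +oo)%E ->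
    (rho \1_E < +oo)%E ;
  bfn_int : forall E : set R, lmeas_set E -> (leb R E < +oo)%E ->
    exists C : R, 0 < C /\ forall f : R -> R, Mplus f ->
      (\int[leb R]_(x in E) (f x)%:E <= C%:E * rho f)%E }.

(* Scalar-valued functions are represented with values in R[i]; the real case
   is the restriction to functions with zero imaginary part. *)
Inductive scalars := RealScalars | ComplexScalars.

Definition scalar_set (R : realType) (K : scalars) : set R[i] :=
  match K with
  | RealScalars => [set z | complex.Im z = 0]
  | ComplexScalars => setT
  end.

Section FunctionSpace.
Variable R : realType.
Implicit Types (K : scalars) (rho : (R -> R) -> \bar R) (f : R -> R[i]).

Definition Mscalar K f : Prop :=
  [/\ forall x, scalar_set K (f x),
      lmeas_fun (fun x => complex.Re (f x)) &
      lmeas_fun (fun x => complex.Im (f x))].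

Definition bfs_norm rho f : \bar R := rho (fun x => Normc.normc (f x)).

Definition bfs K rho : set (R -> R[i]) :=
  [set f | Mscalar K f /\ (bfs_norm rho f < +oo)%E].

Definition cintegrable (E : set R) f : Prop :=
  (leb R).-integrable E (fun x => (complex.Re (f x))%:E) /\
  (leb R).-integrable E (fun x => (complex.Im (f x))%:E).

Definition cintegral (E : set R) f : R[i] :=
  (\int[leb R]_(x in E) complex.Re (f x)) +i*
  (\int[leb R]_(x in E) complex.Im (f x)).

(* An operator whose value at f is only defined at some points; op_val is
   meaningful only where op_dom holds. *)
Record operator := Operator {
  op_dom : (R -> R[i]) -> R -> Prop ;
  op_val : (R -> R[i]) -> R -> R[i] }.

(* Since the measure is complete, the junk values of op_val on the null set
   where op_dom fails affect neither membership in bfs nor the norm. *)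
Definition bounded_by K rho (T : operator) (C : R) : Prop :=
  forall f, bfs K rho f ->
    [/\ {ae leb R, forall x : R, op_dom T f x},
        bfs K rho (op_val T f) &
        (bfs_norm rho (op_val T f) <= C%:E * bfs_norm rho f)%E].

Definition bounded_on K rho (T : operator) : Prop :=
  exists C : R, bounded_by K rho T C.

Definition uniformly_bounded_on K rho (I : set R) (T : R -> operator) : Prop :=
  exists C : R, forall s, I s -> bounded_by K rho (T s) C.

Definition translation (k : R) : operator :=
  Operator (fun _ _ => True) (fun f x => f (x - k)).

Definition averaging (s : R) : operator :=
  Operator
    (fun f x => cintegrable `[x - s, x + s] f)
    (fun f x => ((2 * s)^-1)%:C * cintegral `[x - s, x + s] f).

Definition segment_multiplier : operator :=
  Operator
    (fun f x => cintegrable setT (fun y => (sin (x - y) / (x - y))%:C * f y))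
    (fun f x => cintegral setT (fun y => (sin (x - y) / (x - y))%:C * f y)).

Definition truncated_hilbert : operator :=
  Operator
    (fun f x => cintegrable [set y | 1 <= `|x - y|]
                  (fun y => ((x - y)^-1)%:C * f y))
    (fun f x => cintegral [set y | 1 <= `|x - y|]
                  (fun y => ((x - y)^-1)%:C * f y)).

End FunctionSpace.

(* Main.v *)
Require Import Defs.
From mathcomp Require Import all_boot all_order all_algebra.
From mathcomp Require Import all_classical all_reals all_analysis measurable_realfun.
From mathcomp Require Import complex.
From mathcomp Require Import ring lra.
Set Implicit Arguments.
Unset Strict Implicit.
Unset Printing Implicit Defensive.
Import Order.TTheory GRing.Theory Num.Theory.
Import numFieldNormedType.Exports.
Import ComplexField.
Local Open Scope classical_set_scope.
Local Open Scope complex_scope.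
Local Open Scope ring_scope.

(** Up to kernels of size O(1/(1+t^2)), the kernels sinc t = sin t / t of [S]
and h t = 1_{|t| >= 1} / t of [H_1] are obtained from one another by operations
that preserve boundedness on X.

Multiplying a convolution kernel k(x-y) by cos (x-y) or sin (x-y) keeps it
bounded: the addition formulas write cos (x-y) = cos x cos y + sin x sin y, and
likewise for the sine, so that the new operator is a combination of
f |-> a(x) T(b f)(x) with |a|, |b| <= 1, and the modulations f |-> b f are
contractions of X by the lattice property of the norm
([dominatedM_separated]). Shifting a kernel, k(t + c), composes the operator
with a translation of X ([dominated_shift]). Finally, a kernel bounded by
c/(1+t^2) is bounded by the sum over j of c 4^-j 1_{|t| <= 2^(j+1)}, hence its
operator by the sum over j of 4 c 2^-j B_s |f| with s = 2^(j+1), whose norm is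
controlled by the uniform bound on the averages and by the Fatou property
([poisson_potential], [dominated_poisson]).

With these three facts the theorem follows from two identities:
sinc t = sin t h(t) + O(1/(1+t^2)) ([sinc_sub_hilbert]), and
h(t) = sin^2 t / t + cos^2 t / (t + pi/2) + O(1/(1+t^2))
([hilbert_sub_sinc]). In the second one the first term is sin t sinc t and,
since sin (t + pi/2) = cos t, the second term is cos t sinc (t + pi/2): the two
squares add up to 1, and replacing t by t + pi/2 in a denominator costs
O(1/t^2).

Integrals converge only almost everywhere. The bookkeeping is done by the
predicate [dominated], in which the bound on the operator is expressed by a
pointwise a.e. majorant of controlled norm; a.e. statements are translated by
applying the boundedness of translations to the indicator of a null set
([ae_translate]). *)

(** * Lebesgue measurability and almost everywhere statements *)

Section Measurability.
Variable R : realType.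
Implicit Types (f g k : R -> R) (F : R -> R[i]).

Lemma borel_lmeas k : measurable_fun [set: R] k -> lmeas_fun k.
Proof.
by move=> mk _ Y mY; apply: sub_caratheodory; exact: (mk measurableT Y mY).
Qed.

Lemma borel_sin : measurable_fun [set: R] (@sin R).
Proof. by apply: continuous_measurable_fun; exact: continuous_sin. Qed.

Lemma borel_cos : measurable_fun [set: R] (@cos R).
Proof. by apply: continuous_measurable_fun; exact: continuous_cos. Qed.

Lemma borel_inv : measurable_fun [set: R] (fun t : R => t^-1).
Proof.
have oD : open [set t : R | t != 0] by exact: open_neq.
rewrite (_ : (fun t : R => t^-1) = (fun t : R => t^-1) \_ [set t | t != 0]).
  apply/(measurable_restrictT (D := [set t : R | t != 0])).
    exact: open_measurable.
  apply: open_continuous_measurable_fun => // t; rewrite inE /= => t0.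
  exact: inv_continuous.
(* At the origin both sides are 0: x / 0 = 0 and the restriction is 0. *)
apply/funext => t; rewrite patchE; case: ifP => //.
move=> /negbT; rewrite notin_setE /= => /negP; rewrite negbK => /eqP ->.
by rewrite invr0.
Qed.

Lemma lmeas_cst (c : R) : lmeas_fun (fun=> c).
Proof. exact: measurable_cst. Qed.

Lemma lmeasD f g : lmeas_fun f -> lmeas_fun g -> lmeas_fun (fun x => f x + g x).
Proof. exact: measurable_funD. Qed.

Lemma lmeasM f g : lmeas_fun f -> lmeas_fun g -> lmeas_fun (fun x => f x * g x).
Proof. exact: measurable_funM. Qed.

Lemma lmeas_normr f : lmeas_fun f -> lmeas_fun (fun x => `|f x|).
Proof. by move=> mf; exact: measurableT_comp. Qed.

Lemma lmeas_comp k f : measurable_fun [set: R] k -> lmeas_fun f ->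
  lmeas_fun (fun x => k (f x)).
Proof. by move=> mk mf; exact: (measurableT_comp mk mf). Qed.

Lemma lmeas_normc F : lmeas_fun (fun x => complex.Re (F x)) ->
  lmeas_fun (fun x => complex.Im (F x)) ->
  lmeas_fun (fun x => Normc.normc (F x)).
Proof.
move=> mr mi.
have := @lmeas_comp (@Num.sqrt R) _ (continuous_measurable_fun (@sqrt_continuous R))
  (lmeasD (lmeasM mr mr) (lmeasM mi mi)).
by congr lmeas_fun; apply/funext => x; rewrite -!expr2; case: (F x).
Qed.

Lemma lmeas_kernel_prod k g : measurable_fun [set: R] k -> lmeas_fun g ->
  measurable_fun [set: lebT R * lebT R]
    (fun z : lebT R * lebT R => k ((z.1 : R) - z.2) * g z.2).
Proof.
move=> mk mg.
have mid : measurable_fun [set: lebT R] (id : lebT R -> R).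
  by apply: (@borel_lmeas id); exact: measurable_id.
apply: measurable_funM.
  apply: (measurableT_comp mk); apply: measurable_funB.
    exact: (measurableT_comp mid measurable_fst).
  exact: (measurableT_comp mid measurable_snd).
exact: (measurableT_comp mg measurable_snd).
Qed.

Lemma lmeas_kernel_section k g (x : R) : measurable_fun [set: R] k -> lmeas_fun g ->
  lmeas_fun (fun y => k (x - y) * g y).
Proof.
move=> mk mg; apply: lmeasM => //; apply: lmeas_comp => //.
by apply: borel_lmeas; apply: measurable_funB.
Qed.

(** Tonelli applied to the positive and negative parts; replacing an infinite
value by 0 is a Borel operation, so measurability extends to the points x where
the integral diverges. *)
Lemma lmeas_convolution k g : measurable_fun [set: R] k -> lmeas_fun g ->
  lmeas_fun (fun x => \int[leb R]_y (k (x - y) * g y)).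
Proof.
move=> mk mg.
pose F (z : lebT R * lebT R) : \bar R := (k ((z.1 : R) - z.2) * g z.2)%:E.
have mF : measurable_fun [set: lebT R * lebT R] F.
  by apply/measurable_EFinP; exact: lmeas_kernel_prod.
rewrite /lmeas_fun.
rewrite (_ : (fun x => _) = fine \o (fubini_F (leb R) F^\+ \- fubini_F (leb R) F^\-)%E).
  apply: measurableT_comp; first exact: fine_measurable.
  apply: emeasurable_funB.
    by apply: measurable_fun_fubini_tonelli_F => //; exact: measurable_funepos.
  by apply: measurable_fun_fubini_tonelli_F => //; exact: measurable_funeneg.
apply/funext => x; rewrite /= /Rintegral; congr fine.
rewrite integralE /fubini_F.
by congr (_ - _)%E; apply: eq_integral => y _; rewrite unlock.
Qed.

Lemma lmeas_itv (i : interval R) : lmeas_set [set` i].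
Proof. by apply: sub_caratheodory; exact: measurable_itv. Qed.

Lemma ae_all (P : R -> Prop) : (forall x, P x) -> {ae leb R, forall x : R, P x}.
Proof. by move=> Px; apply: aeW. Qed.

Lemma ae_sub (P Q : R -> Prop) : (forall x, P x -> Q x) ->
  {ae leb R, forall x : R, P x} -> {ae leb R, forall x : R, Q x}.
Proof. exact: (@filterS _ _ (ae_filter_ringOfSetsType (leb R)) P Q). Qed.

Lemma ae_and (P Q : R -> Prop) : {ae leb R, forall x : R, P x} ->
  {ae leb R, forall x : R, Q x} -> {ae leb R, forall x : R, P x /\ Q x}.
Proof. exact: (@filterI _ _ (ae_filter_ringOfSetsType (leb R)) P Q). Qed.

End Measurability.

(** * Integrals of complex-valued functions *)

Section ComplexIntegral.
Variable R : realType.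
Implicit Types (F G : R -> R[i]).

Lemma Re_realM (a : R) (z : R[i]) : complex.Re (a%:C * z) = a * complex.Re z.
Proof. by case: z => u v /=; ring. Qed.

Lemma Im_realM (a : R) (z : R[i]) : complex.Im (a%:C * z) = a * complex.Im z.
Proof. by case: z => u v /=; ring. Qed.

Lemma normc_real (a : R) : Normc.normc a%:C = `|a|.
Proof. by rewrite /Normc.normc /= expr0n addr0 sqrtr_sqr. Qed.

Lemma normc_realM (a : R) (z : R[i]) :
  Normc.normc (a%:C * z) = `|a| * Normc.normc z.
Proof. by rewrite Normc.normcM normc_real. Qed.

Lemma normc_ge0 (z : R[i]) : 0 <= Normc.normc z.
Proof. by case: z => a b; exact: sqrtr_ge0. Qed.

Lemma normcD_le (z w : R[i]) :
  Normc.normc (z + w) <= Normc.normc z + Normc.normc w.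
Proof. exact: (@le_normcD R). Qed.

Lemma Re_le_normc (z : R[i]) : `|complex.Re z| <= Normc.normc z.
Proof.
by case: z => a b /=; rewrite -sqrtr_sqr ler_wsqrtr// lerDl sqr_ge0.
Qed.

Lemma Im_le_normc (z : R[i]) : `|complex.Im z| <= Normc.normc z.
Proof.
by case: z => a b /=; rewrite -sqrtr_sqr ler_wsqrtr// lerDr sqr_ge0.
Qed.

Lemma normc_le_ReIm (a b : R) : Normc.normc (a +i* b) <= `|a| + `|b|.
Proof.
rewrite /= -[leRHS]ger0_norm ?addr_ge0// -sqrtr_sqr ler_wsqrtr//.
rewrite -[a ^+ 2]real_normK ?num_real// -[b ^+ 2]real_normK ?num_real//.
have := mulr_ge0 (normr_ge0 a) (normr_ge0 b); nra.
Qed.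

Lemma cintegrableD F G : cintegrable setT F -> cintegrable setT G ->
  cintegrable setT (fun y => F y + G y).
Proof.
move=> [Fr Fi] [Gr Gi]; split.
- have := integrableD measurableT Fr Gr; congr (_.-integrable _ _).
  by apply/funext => y /=; case: (F y) (G y) => [? ?] [? ?].
- have := integrableD measurableT Fi Gi; congr (_.-integrable _ _).
  by apply/funext => y /=; case: (F y) (G y) => [? ?] [? ?].
Qed.

Lemma cintegralD F G : cintegrable setT F -> cintegrable setT G ->
  cintegral setT (fun y => F y + G y) = cintegral setT F + cintegral setT G.
Proof.
move=> [Fr Fi] [Gr Gi]; rewrite /cintegral; apply/eqP; rewrite eq_complex /=.
rewrite -!RintegralD//; apply/andP; split; apply/eqP; apply: eq_Rintegral => y _.
  by case: (F y) (G y) => [? ?] [? ?].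
by case: (F y) (G y) => [? ?] [? ?].
Qed.

Lemma cintegrableZ (a : R) F : cintegrable setT F ->
  cintegrable setT (fun y => a%:C * F y).
Proof.
move=> [Fr Fi]; split.
- have := integrableZl measurableT a Fr; congr (_.-integrable _ _).
  by apply/funext => y /=; rewrite Re_realM.
- have := integrableZl measurableT a Fi; congr (_.-integrable _ _).
  by apply/funext => y /=; rewrite Im_realM.
Qed.

Lemma cintegralZ (a : R) F : cintegrable setT F ->
  cintegral setT (fun y => a%:C * F y) = a%:C * cintegral setT F.
Proof.
move=> [Fr Fi]; rewrite /cintegral; apply/eqP.
rewrite eq_complex Re_realM Im_realM /=.
rewrite -!RintegralZl//; apply/andP; split; apply/eqP; apply: eq_Rintegral => y _.
  by rewrite Re_realM.
by rewrite Im_realM.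
Qed.

Lemma real_integral_dominated (g h : R -> R) (M : R) :
  lmeas_fun g -> lmeas_fun h -> (forall y, `|g y| <= h y) ->
  (\int[leb R]_y (h y)%:E <= M%:E)%E ->
  (leb R).-integrable setT (EFin \o g) /\ `|\int[leb R]_y g y| <= M.
Proof.
move=> mg mh gh hM.
have abs_le : (\int[leb R]_y `|g y|%:E <= \int[leb R]_y (h y)%:E)%E.
  apply: ge0_le_integral; [exact: measurableT|by []| | |].
  - by apply/measurable_EFinP; exact: lmeas_normr.
  - exact/measurable_EFinP.
  - by move=> y _; rewrite lee_fin.
have intg : (leb R).-integrable setT (EFin \o g).
  apply/integrableP; split; first exact/measurable_EFinP.
  apply: (@le_lt_trans _ _ M%:E); last exact: ltry.
  exact: le_trans abs_le hM.
split=> //; apply: (le_trans (le_normr_Rintegral measurableT intg)).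
rewrite -lee_fin /Rintegral fineK; first exact: le_trans abs_le hM.
exact: integrable_fin_num (integrable_norm intg).
Qed.

(** The factor 2 comes from estimating the real and the imaginary part
separately. *)
Lemma cintegral_dominated F (h : R -> R) (M : R) :
  lmeas_fun (fun x => complex.Re (F x)) ->
  lmeas_fun (fun x => complex.Im (F x)) ->
  lmeas_fun h -> (forall y, Normc.normc (F y) <= h y) ->
  (\int[leb R]_y (h y)%:E <= M%:E)%E ->
  cintegrable setT F /\ Normc.normc (cintegral setT F) <= 2 * M.
Proof.
move=> mr mi mh Fh hM.
have [ir nr] := real_integral_dominated mr mh
  (fun y => le_trans (Re_le_normc (F y)) (Fh y)) hM.
have [ii ni] := real_integral_dominated mi mh
  (fun y => le_trans (Im_le_normc (F y)) (Fh y)) hM.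
split=> //; rewrite mulr_natl mulr2n.
exact: (le_trans (normc_le_ReIm _ _) (lerD nr ni)).
Qed.

End ComplexIntegral.

(** * Banach function norms *)

Section FunctionNorm.
Variables (R : realType) (K : scalars) (rho : (R -> R) -> \bar R).
Hypothesis hrho : banach_function_norm rho.
Implicit Types (f : R -> R[i]) (g h k : R -> R).

Lemma Mplus_normc f : Mscalar K f -> Mplus (fun x => Normc.normc (f x)).
Proof.
by case=> _ mr mi; split=> [|x]; [exact: lmeas_normc|exact: normc_ge0].
Qed.

Lemma MplusD g h : Mplus g -> Mplus h -> Mplus (fun x => g x + h x).
Proof.
by move=> [mg g0] [mh h0]; split=> [|x]; [exact: lmeasD|exact: addr_ge0].
Qed.

Lemma MplusZ (c : R) g : 0 <= c -> Mplus g -> Mplus (fun x => c * g x).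
Proof.
move=> c0 [mg g0]; split=> [|x]; last exact: mulr_ge0.
by apply: lmeasM => //; exact: lmeas_cst.
Qed.

Lemma bfs_normE f : bfs K rho f ->
  exists2 n : R, 0 <= n & bfs_norm rho f = n%:E.
Proof.
move=> [mf ltf].
have n0 : (0 <= bfs_norm rho f)%E by exact: (bfn_ge0 hrho (Mplus_normc mf)).
exists (fine (bfs_norm rho f)); first by rewrite fine_ge0.
by rewrite fineK// ge0_fin_numE.
Qed.

Lemma Mscalar_real g : lmeas_fun g -> Mscalar K (fun x => (g x)%:C).
Proof.
move=> mg; split=> [x| |]; [by case: K|exact: mg|exact: lmeas_cst].
Qed.

Lemma Mscalar_realM g f : lmeas_fun g -> Mscalar K f ->
  Mscalar K (fun x => (g x)%:C * f x).
Proof.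
move=> mg [fK mr mi]; split.
- move=> x; have := fK x; case: K => //=.
  by case: (f x) => a b /= ->; ring.
- have := lmeasM mg mr; congr lmeas_fun.
  by apply/funext => x; rewrite Re_realM.
- have := lmeasM mg mi; congr lmeas_fun.
  by apply/funext => x; rewrite Im_realM.
Qed.

(** The lattice property of X, in the form in which every membership in X is
established below. *)
Lemma bfs_dominated f h (M : R) : Mscalar K f -> Mplus h ->
  (rho h <= M%:E)%E -> {ae leb R, forall x : R, Normc.normc (f x) <= h x} ->
  bfs K rho f /\ (bfs_norm rho f <= M%:E)%E.
Proof.
move=> mf mh hM fh.
have fM : (bfs_norm rho f <= M%:E)%E.
  exact: le_trans (bfn_mono hrho (Mplus_normc mf) mh fh) hM.
by split=> //; split=> //; apply: le_lt_trans fM (ltry _).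
Qed.

Lemma bfs_modulate (b : R -> R) f : lmeas_fun b -> (forall y, `|b y| <= 1) ->
  bfs K rho f -> bfs K rho (fun y => (b y)%:C * f y) /\
  (bfs_norm rho (fun y => (b y)%:C * f y)%R <= bfs_norm rho f)%E.
Proof.
move=> mb b1 Xf; have [n n0 fn] := bfs_normE Xf; rewrite fn.
apply: (@bfs_dominated _ (fun x => Normc.normc (f x))).
- exact: Mscalar_realM Xf.1.
- exact: Mplus_normc Xf.1.
- by rewrite -fn.
- apply: ae_all => x; rewrite normc_realM ler_piMl//; exact: normc_ge0.
Qed.

Lemma bfs_real g (M : R) : Mplus g -> (rho g <= M%:E)%E ->
  bfs K rho (fun x => (g x)%:C) /\
  (bfs_norm rho (fun x => (g x)%:C)%R <= M%:E)%E.
Proof.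
move=> mg gM; apply: (@bfs_dominated _ g) => //.
  by apply: Mscalar_real; exact: mg.1.
by apply: ae_all => x; rewrite normc_real ger0_norm ?mg.2.
Qed.

Lemma Mplus_indic (E : set R) : lmeas_set E -> Mplus (\1_E : R -> R).
Proof.
by move=> mE; split=> [|x]; [exact: (@measurable_indic _ (lebT R) R setT E)|
  rewrite indicE].
Qed.

(** The Fatou property when the pointwise limit is not known to be finite. The
limit is infinite on N, the intersection over M of the sets E_M where some u_n
is at least M; there M 1_(E_M) is an increasing limit of functions below the
u_n, so M rho(1_N) <= B for all M and N is null. Off N the limit is finite and
the Fatou property applies directly. *)
Lemma bfn_monotone_sup (u : nat -> R -> R) (B : R) :
  (forall n, Mplus (u n)) -> (forall x, nondecreasing_seq (u ^~ x)) ->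
  (forall n, rho (u n) <= B%:E)%E ->
  exists h, [/\ Mplus h, (rho h <= B%:E)%E &
    {ae leb R, forall x : R, forall n, u n x <= h x}].
Proof.
move=> mu ndu uB.
have B0 : 0 <= B by rewrite -lee_fin (le_trans _ (uB 0)) ?(bfn_ge0 hrho).
pose E M : set R := \bigcup_n [set x | (M%:R : R) <= u n x].
pose N : set R := \bigcap_M E M.
have mge M n : lmeas_set [set x | (M%:R : R) <= u n x].
  have := (@measurable_fun_ler _ (lebT R) R setT _ _ (@lmeas_cst R M%:R) (mu n).1)
    measurableT [set true] I.
  by rewrite setTI.
have mE M : lmeas_set (E M).
  by apply: (@bigcupT_measurable _ (lebT R)) => n; exact: mge.
have mN : lmeas_set N.
  by apply: (@bigcapT_measurable _ (lebT R)) => M; exact: mE.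
have rhoE (M : nat) : (M%:R%:E * rho \1_(E M) <= B%:E)%E.
  pose v n x : R := M%:R * \1_[set x | (M%:R : R) <= u n x] x.
  have mv n : Mplus (v n) by apply: MplusZ => //; exact: Mplus_indic.
  have mEM : Mplus (fun x => M%:R * \1_(E M) x : R).
    by apply: MplusZ => //; exact: Mplus_indic.
  rewrite -(bfn_homo hrho) ?ler0n//; last exact: Mplus_indic.
  have vcvg x : nondecreasing_seq (v ^~ x) /\
      v n x @[n --> \oo] --> (M%:R * \1_(E M) x : R).
    split.
      move=> m n mn; rewrite /v ler_wpM2l// !indicE ler_nat.
      case: (boolP (x \in [set x | _ <= u m x])) => //.
      rewrite inE /= => Mm; rewrite mem_set//=.
      exact: le_trans Mm (ndu x _ _ mn).
    rewrite indicE; case: (boolP (x \in E M)); rewrite ?inE ?notin_setE.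
      move=> [n0 _ /= Mn0]; apply: cvg_near_cst.
      exists n0 => // n /= n0n; rewrite /v indicE mem_set//=.
      exact: le_trans Mn0 (ndu x _ _ n0n).
    move=> nE; apply: cvg_near_cst; apply: nearW => n.
    rewrite /v indicE memNset// => /= Mn; apply: nE; by exists n.
  have [_ vl] := bfn_fatou hrho mv mEM (ae_all vcvg).
  rewrite -(cvg_lim _ vl)//; apply: lime_le; first by apply/cvg_ex; eexists; exact: vl.
  apply: nearW => n; apply: (le_trans _ (uB n)).
  apply: (bfn_mono hrho) => //; apply: ae_all => x; rewrite /v indicE.
  case: (boolP (_ \in _)) => [|_]; last by rewrite mulr0 (mu n).2.
  by rewrite inE /= mulr1.
have rhoN M : (M%:R%:E * rho \1_N <= B%:E)%E.
  apply: le_trans (rhoE M); rewrite lee_wpmul2l ?lee_fin ?ler0n//.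
  apply: (bfn_mono hrho); [exact: Mplus_indic|exact: Mplus_indic|].
  apply: ae_all => x; rewrite !indicE ler_nat.
  case: (boolP (x \in N)) => //; rewrite inE => /(_ M I) xE.
  by rewrite mem_set.
have N0 : {ae leb R, forall x : R, \1_N x = 0 :> R}.
  apply/(bfn_eq0 hrho (Mplus_indic mN)).
  have r0 := bfn_ge0 hrho (Mplus_indic mN).
  have rfin : rho \1_N \is a fin_num.
    rewrite ge0_fin_numE//; apply: le_lt_trans (ltry B).
    by have := rhoN 1%N; rewrite mul1e.
  move: r0 rhoN; rewrite -(fineK rfin) lee_fin; set r := fine _ => r0 rB.
  congr EFin; apply/eqP; rewrite eq_le r0 andbT leNgt; apply/negP => rp.
  have := rB (Num.truncn (B / r)).+1; rewrite -EFinM lee_fin leNgt => /negP; apply.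
  by rewrite -ltr_pdivrMr// truncnS_gt// divr_ge0.
(* Cutting u_n off on N makes the limit finite at every point. *)
pose w n x : R := \1_(~` N) x * u n x.
have mNC : lmeas_set (~` N) by exact: (@measurableC _ (lebT R)).
have mw n : Mplus (w n).
  split=> [|x]; last by rewrite mulr_ge0 ?(mu n).2// indicE.
  apply: lmeasM (mu n).1; exact: (Mplus_indic mNC).1.
have ndw x : nondecreasing_seq (w ^~ x).
  by move=> m n mn; rewrite ler_wpM2l ?ndu// indicE.
have cw x : cvgn (w ^~ x).
  apply: nondecreasing_is_cvgn => //.
  have [xN|xN] := pselect (N x).
    exists 0 => _ [n _ <-]; by rewrite /w indicE memNset ?mul0r//; apply.
  have : exists M, ~ E M x.
    by apply: contrapT => /forallNP xE; apply: xN => M _; apply: contrapT.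
  move=> [M xM]; exists M%:R => _ [n _ <-]; rewrite /w indicE mem_set// mul1r.
  rewrite leNgt; apply/negP => /ltW uM; apply: xM; by exists n.
pose h x : R := limn (w ^~ x).
have wh n x : w n x <= h x by exact: nondecreasing_cvgn_le.
have mh : Mplus h.
  split=> [|x]; last by apply: le_trans (wh 0 x); exact: (mw 0).2.
  exact: (@measurable_fun_cvg _ (lebT R) R setT w h (fun n => (mw n).1) (fun x _ => cw x)).
exists h; split=> //.
  have [|_ wl] := bfn_fatou hrho mw mh.
    by apply: ae_all => x; split; [exact: ndw|exact: cw].
  rewrite -(cvg_lim _ wl)//; apply: lime_le; first by apply/cvg_ex; eexists; exact: wl.
  apply: nearW => n; apply: (le_trans _ (uB n)).
  apply: (bfn_mono hrho) => //; apply: ae_all => x.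
  by rewrite ler_piMl ?(mu n).2// indicE lern1 leq_b1.
apply: ae_sub N0 => x; rewrite indicE => xN n.
apply: le_trans (wh n x); rewrite /w indicE in_setC.
by case: (x \in N) xN => /=; [move=> /eqP; rewrite oner_eq0|rewrite mul1r].
Qed.

End FunctionNorm.

(** * Kernel operators *)

(* Simplification must expose the integral defining an operator without
   splitting it into real and imaginary parts. *)
Local Arguments cintegral : simpl never.
Local Arguments Normc.normc : simpl never.

Section Kernels.
Variables (R : realType) (K : scalars) (rho : (R -> R) -> \bar R).
Hypothesis hrho : banach_function_norm rho.
Implicit Types (f : R -> R[i]) (g h k : R -> R).

Definition kernel_op k : operator R :=
  Operator
    (fun f x => cintegrable setT (fun y => (k (x - y))%:C * f y))
    (fun f x => cintegral setT (fun y => (k (x - y))%:C * f y)).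

(** Boundedness of a kernel operator, rephrased through a majorant. A pointwise
a.e. identity between kernel operators transfers to majorants at once, whereas
the values of the operators at points of divergence need not match. *)
Definition dominated k := exists2 C : R, 0 <= C &
  forall f, bfs K rho f -> exists h, [/\ Mplus h,
    (rho h <= C%:E * bfs_norm rho f)%E &
    {ae leb R, forall x : R, op_dom (kernel_op k) f x /\
      Normc.normc (op_val (kernel_op k) f x) <= h x}].

Lemma Mscalar_kernel_op k f : measurable_fun [set: R] k -> Mscalar K f ->
  Mscalar K (op_val (kernel_op k) f).
Proof.
move=> mk [fK mr mi]; split.
- move=> x; move: fK; case: K => //= f0; rewrite /Rintegral.
  rewrite [X in fine X](_ : _ = 0%E)//; apply: integral0_eq => y _.
  by rewrite Im_realM f0 mulr0.
- have := lmeas_convolution mk mr; congr lmeas_fun.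
  by apply/funext => x /=; apply: eq_Rintegral => y _; rewrite Re_realM.
- have := lmeas_convolution mk mi; congr lmeas_fun.
  by apply/funext => x /=; apply: eq_Rintegral => y _; rewrite Im_realM.
Qed.

(** For the converse implication the only thing a majorant does not give is the
measurability of the operator's values; the kernel being Borel, it comes from
[lmeas_convolution]. *)
Lemma bounded_kernel_opP k : measurable_fun [set: R] k ->
  bounded_on K rho (kernel_op k) <-> dominated k.
Proof.
move=> mk; split=> [[C kC]|[C C0 kC]].
  exists `|C| => // f Xf; have [domf XTf Tfle] := kC f Xf.
  exists (fun x => Normc.normc (op_val (kernel_op k) f x)); split.
  - exact: Mplus_normc XTf.1.
  - apply: (le_trans Tfle); have [n n0 ->] := bfs_normE hrho Xf.
    by rewrite -!EFinM lee_fin ler_wpM2r// ler_norm.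
  - by apply: ae_sub domf.
exists C => f Xf; have [h [mh hC domf]] := kC f Xf.
have [n n0 fn] := bfs_normE hrho Xf; rewrite fn in hC *.
have [XTf Tfle] := bfs_dominated hrho (Mscalar_kernel_op mk Xf.1) mh hC
  (ae_sub (fun x => @proj2 _ _) domf).
by split=> //; apply: ae_sub domf => x [].
Qed.

Lemma dominatedD k1 k2 : dominated k1 -> dominated k2 ->
  dominated (fun t => k1 t + k2 t).
Proof.
move=> [C1 C10 d1] [C2 C20 d2]; exists (C1 + C2); first exact: addr_ge0.
move=> f Xf; have [h1 [mh1 h1C a1]] := d1 f Xf; have [h2 [mh2 h2C a2]] := d2 f Xf.
exists (fun x => h1 x + h2 x); split; first exact: MplusD.
  apply: (le_trans (bfn_triangle hrho mh1 mh2)).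
  have [n n0 fn] := bfs_normE hrho Xf; rewrite fn in h1C h2C *.
  by rewrite -EFinM mulrDl EFinD !EFinM leeD.
apply: ae_sub (ae_and a1 a2) => x /= [[i1 l1] [i2 l2]].
rewrite (_ : (fun y => _) = fun y =>
  (k1 (x - y))%:C * f y + (k2 (x - y))%:C * f y); last first.
  by apply/funext => y; rewrite raddfD mulrDl.
split; first exact: cintegrableD.
by rewrite cintegralD//; apply: (le_trans (normcD_le _ _)); exact: lerD.
Qed.

(** With m(x - y) = a1(x) b1(y) + a2(x) b2(y), the operator of kernel m k is
f |-> a1 T(b1 f) + a2 T(b2 f), where T has kernel k; multiplication by b1 and
b2 contracts X, and multiplication by a1 and a2 does not increase a majorant. *)
Lemma dominatedM_separated k (m a1 b1 a2 b2 : R -> R) :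
  (forall x y, m (x - y) = a1 x * b1 y + a2 x * b2 y) ->
  lmeas_fun b1 -> lmeas_fun b2 ->
  (forall x, `|a1 x| <= 1) -> (forall x, `|b1 x| <= 1) ->
  (forall x, `|a2 x| <= 1) -> (forall x, `|b2 x| <= 1) ->
  dominated k -> dominated (fun t => m t * k t).
Proof.
move=> mE mb1 mb2 a11 b11 a21 b21 [C C0 d].
exists (C + C); first exact: addr_ge0.
move=> f Xf.
have [X1 n1] := bfs_modulate hrho mb1 b11 Xf.
have [X2 n2] := bfs_modulate hrho mb2 b21 Xf.
have [h1 [mh1 h1C e1]] := d _ X1; have [h2 [mh2 h2C e2]] := d _ X2.
have [n n0 fn] := bfs_normE hrho Xf; rewrite fn in n1 n2 *.
exists (fun x => h1 x + h2 x); split; first exact: MplusD.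
  apply: (le_trans (bfn_triangle hrho mh1 mh2)).
  rewrite -EFinM mulrDl EFinD !EFinM leeD//.
    by apply: (le_trans h1C); rewrite lee_wpmul2l// lee_fin.
  by apply: (le_trans h2C); rewrite lee_wpmul2l// lee_fin.
apply: ae_sub (ae_and e1 e2) => x /= [[i1 l1] [i2 l2]].
rewrite (_ : (fun y => _) = fun y =>
  (a1 x)%:C * ((k (x - y))%:C * ((b1 y)%:C * f y)) +
  (a2 x)%:C * ((k (x - y))%:C * ((b2 y)%:C * f y))); last first.
  apply/funext => y; rewrite mE; case: (f y) => u v.
  by apply/eqP; rewrite eq_complex /=; apply/andP; split; apply/eqP; ring.
have j1 := cintegrableZ (a1 x) i1; have j2 := cintegrableZ (a2 x) i2.
split; first exact: cintegrableD.
rewrite cintegralD// !cintegralZ//; apply: (le_trans (normcD_le _ _)).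
rewrite !normc_realM; apply: lerD.
  by apply: le_trans l1; rewrite ler_piMl ?normc_ge0.
by apply: le_trans l2; rewrite ler_piMl ?normc_ge0.
Qed.

Lemma dominated_cosM k : dominated k -> dominated (fun t => cos t * k t).
Proof.
apply: (@dominatedM_separated _ _ (@cos R) (@cos R) (@sin R) (@sin R)).
- by move=> x y; rewrite cosB.
- exact: borel_lmeas (@borel_cos R).
- exact: borel_lmeas (@borel_sin R).
- exact: cos_max.
- exact: cos_max.
- exact: sin_max.
- exact: sin_max.
Qed.

Lemma dominated_sinM k : dominated k -> dominated (fun t => sin t * k t).
Proof.
apply: (@dominatedM_separated _ _ (@sin R) (@cos R) (fun x => - cos x) (@sin R)).
- by move=> x y; rewrite sinB mulNr.
- exact: borel_lmeas (@borel_cos R).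
- exact: borel_lmeas (@borel_sin R).
- exact: sin_max.
- exact: cos_max.
- by move=> x; rewrite normrN; exact: cos_max.
- exact: sin_max.
Qed.

Hypothesis hT : forall c : R, bounded_on K rho (translation c).

(** The indicator of a null set has norm 0, hence so does its translate: the
boundedness of translations on X carries null sets to null sets. *)
Lemma ae_translate (P : R -> Prop) (c : R) : {ae leb R, forall x : R, P x} ->
  {ae leb R, forall x : R, P (x + c)}.
Proof.
move=> [N [mN N0 PN]].
have N1 : rho \1_N = 0%E.
  apply/(bfn_eq0 hrho (Mplus_indic mN)); exists N; split=> //.
  move=> x /= xN; apply: contrapT => nN; apply: xN; by rewrite indicE memNset.
have N1C : (rho \1_N <= 0%:E)%E by rewrite N1.
have [XN nN] := bfs_real K hrho (Mplus_indic mN) N1C.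
have [C TC] := hT (- c).
have [_ XT nT] := TC _ XN.
have nN0 : bfs_norm rho (fun x => (\1_N x)%:C) = 0%E.
  by apply/eqP; rewrite eq_le nN (bfn_ge0 hrho (Mplus_normc XN.1)).
rewrite nN0 mule0 in nT.
have T0 : bfs_norm rho (op_val (translation (- c)) (fun x => (\1_N x)%:C)) = 0%E.
  by apply/eqP; rewrite eq_le nT (bfn_ge0 hrho (Mplus_normc XT.1)).
move/(bfn_eq0 hrho (Mplus_normc XT.1)): T0; apply: ae_sub => x /=.
rewrite opprK normc_real indicE => /normr0_eq0 xN.
apply: contrapT => nP; have : N (x + c) by apply: PN.
by move=> xcN; move: xN; rewrite mem_set// => /eqP; rewrite oner_eq0.
Qed.

(** Shifting the kernel of T by c gives f |-> (T f)(. + c). It is the majorant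
that gets translated. *)
Lemma dominated_shift k (c : R) : dominated k -> dominated (fun t => k (t + c)).
Proof.
move=> [C C0 d]; have [T TC] := hT (- c).
exists (`|T| * C); first exact: mulr_ge0.
move=> f Xf; have [h [mh hC a]] := d f Xf.
have [n n0 fn] := bfs_normE hrho Xf; rewrite fn in hC *; rewrite -EFinM in hC.
have [Xh nh] := bfs_real K hrho mh hC.
have [_ XT nT] := TC _ Xh.
have hE : (fun x => Normc.normc (op_val (translation (- c)) (fun x => (h x)%:C) x))
    = fun x => h (x + c).
  by apply/funext => x; rewrite /= opprK normc_real ger0_norm ?mh.2.
exists (fun x => h (x + c)); split.
- by rewrite -hE; exact: Mplus_normc XT.1.
- rewrite -hE; apply: (le_trans nT).
  have [m m0 hm] := bfs_normE hrho Xh; rewrite hm in nh *.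
  rewrite -!EFinM !lee_fin in nh *.
  apply: (@le_trans _ _ (`|T| * m)); first by rewrite ler_wpM2r// ler_norm.
  by rewrite -mulrA ler_wpM2l.
- apply: ae_sub (ae_translate c a) => x /=.
  by under eq_fun do rewrite addrAC.
Qed.

End Kernels.

(** * Kernels of size O(1/(1+t^2)) *)

Section PoissonKernel.
Variable R : realType.

(** Take for j the least index with |t| <= 2^(j+1): if j > 0 then |t| > 2^j, so
1 + t^2 >= 4^j. *)
Lemma poisson_le_dyadic (t : R) : exists j : nat,
  `|t| <= 2 ^+ j.+1 /\ (1 + t ^+ 2)^-1 <= (4 ^+ j)^-1.
Proof.
have [m tm] : exists m, `|t| <= 2 ^+ m.+1.
  exists (Num.truncn `|t|).
  apply: (le_trans (ltW (truncnS_gt _))).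
  by rewrite -natrX ler_nat ltnW// ltn_expl.
have Q : exists m, (fun j => `|t| <= 2 ^+ j.+1) m by exists m.
case: (ex_minnP Q) => -[|j] tj jmin.
  exists 0; split=> //; rewrite expr0 invr1 invf_le1 ?ler_wpDr ?lerDl ?sqr_ge0//.
  by rewrite ltr_wpDr// sqr_ge0.
exists j.+1; split=> //.
have tj' : 2 ^+ j.+1 <= `|t|.
  by rewrite leNgt; apply/negP => /ltW /jmin; rewrite ltnn.
rewrite lef_pV2 ?posrE ?exprn_gt0 ?ltr_wpDr ?sqr_ge0//.
rewrite -[t ^+ 2]real_normK ?num_real//.
apply: (@le_trans _ _ (`|t| ^+ 2)); last by rewrite lerDr.
rewrite (_ : 4 = 2 ^+ 2 :> R); last by rewrite -natrX.
by rewrite exprAC ler_pXn2r// ?nnegrE ?exprn_ge0.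
Qed.

Lemma borel_poisson : measurable_fun [set: R] (fun t : R => (1 + t ^+ 2)^-1).
Proof.
by apply: (measurableT_comp (@borel_inv R)); exact: measurable_funD.
Qed.

End PoissonKernel.

Section Potential.
Variables (R : realType) (K : scalars) (rho : (R -> R) -> \bar R).
Hypothesis hrho : banach_function_norm rho.
Implicit Types (f : R -> R[i]) (g h k : R -> R).
Hypothesis hB : uniformly_bounded_on K rho [set s : R | 1 < s] (@averaging R).

(** The absolute value on the right is harmless because the average of a
nonnegative function is nonnegative. *)
Lemma averaging_real g (s x : R) : Mplus g -> 0 < s ->
  op_dom (averaging s) (fun y => (g y)%:C) x ->
  (\int[leb R]_(y in `[(x - s)%R, (x + s)%R]) (g y)%:E)%E =
  (2 * s * Normc.normc (op_val (averaging s) (fun y => (g y)%:C) x))%:E.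
Proof.
move=> [mg g0] s0 [/= ig _].
rewrite normc_realM (_ : Normc.normc _ = \int[leb R]_(y in `[x - s, x + s]) g y).
  rewrite ger0_norm ?invr_ge0 ?mulr_ge0 ?ltW// mulrA divff ?mul1r.
    rewrite /Rintegral fineK//.
    by apply: integrable_fin_num ig; exact: lmeas_itv.
  by apply: mulf_neq0; rewrite ?pnatr_eq0// gt_eqF.
rewrite /cintegral /= [X in _ +i* X](_ : _ = 0).
  by rewrite normc_real ger0_norm//; apply: Rintegral_ge0.
by rewrite /Rintegral integral0_eq.
Qed.

(** The dyadic decomposition bounds the integral by the sum over j of
4^-j times the integral of |f| over [x - s, x + s] with s = 2^(j+1), that is, of
4 2^-j B_s|f|(x). Each B_s|f| has norm at most C |f| because s > 1, so the
partial sums have norm at most 8 C |f|, and [bfn_monotone_sup] bounds their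
limit. *)
Lemma poisson_potential : exists2 C : R, 0 <= C & forall f, bfs K rho f ->
  exists h, [/\ Mplus h, (rho h <= C%:E * bfs_norm rho f)%E &
    {ae leb R, forall x : R,
      (\int[leb R]_y ((1 + (x - y) ^+ 2)^-1 * Normc.normc (f y))%:E
        <= (h x)%:E)%E}].
Proof.
have [C0 BC0] := hB.
pose C := `|C0|; have Cge0 : 0 <= C by exact: normr_ge0.
exists (8 * C); first by rewrite mulr_ge0.
move=> f Xf; have [n n0 fn] := bfs_normE hrho Xf; rewrite fn.
pose g y := Normc.normc (f y).
have mg : Mplus g by exact: Mplus_normc Xf.1.
have gn : (rho g <= n%:E)%E by rewrite -fn.
have [Xg ng] := bfs_real K hrho mg gn.
pose s j : R := 2 ^+ j.+1.
have s1 j : 1 < s j by rewrite exprn_egt1// ltr1n.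
have s0 j : 0 < s j by rewrite (lt_trans _ (s1 j)).
pose T j := op_val (averaging (s j)) (fun y => (g y)%:C).
have XT j : bfs K rho (T j) by have [] := BC0 _ (s1 j) _ Xg.
pose A j x := Normc.normc (T j x).
have mA j : Mplus (A j) by exact: Mplus_normc (XT j).1.
have rA j : (rho (A j) <= (C * n)%:E)%E.
  have [_ _ nT] := BC0 _ (s1 j) _ Xg; apply: (le_trans nT).
  have [m m0 gm] := bfs_normE hrho Xg; rewrite gm in ng *.
  rewrite -!EFinM !lee_fin in ng *.
  apply: (@le_trans _ _ (C * m)); first by rewrite ler_wpM2r// ler_norm.
  by rewrite ler_wpM2l.
(* The coefficient is 2 s / 4^j with s = 2^(j+1). *)
pose c j : R := 4 * 2^-1 ^+ j.
have c0 j : 0 <= c j by rewrite mulr_ge0// exprn_ge0.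
pose u m x := \sum_(j < m) c j * A j x.
have uS m : u m.+1 = fun x => u m x + c m * A m x.
  by apply/funext => x; rewrite /u big_ord_recr.
have mu m : Mplus (u m).
  elim: m => [|m IH]; last by rewrite uS; apply: MplusD => //; exact: MplusZ.
  rewrite (_ : u 0 = fun=> 0); last by apply/funext => x; rewrite /u big_ord0.
  by split=> //; exact: lmeas_cst.
have ndu x : nondecreasing_seq (u ^~ x).
  apply/nondecreasing_seqP => m; rewrite uS lerDl mulr_ge0//; exact: (mA m).2.
have ru m : (rho (u m) <= ((8 - 8 * 2^-1 ^+ m) * (C * n))%:E)%E.
  elim: m => [|m IH].
    rewrite (_ : u 0 = fun x => 0 * g x).
      by rewrite (bfn_homo hrho)// mul0e expr0 mulr1 subrr mul0r.
    by apply/funext => x; rewrite /u big_ord0 mul0r.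
  rewrite uS; apply: (le_trans (bfn_triangle hrho (mu m) (MplusZ (c0 m) (mA m)))).
  rewrite (bfn_homo hrho)//.
  rewrite (_ : (8 - _) * _ = (8 - 8 * 2^-1 ^+ m) * (C * n) + c m * (C * n)).
    rewrite EFinD leeD// (EFinM (c m)) lee_wpmul2l ?lee_fin//.
  by rewrite /c exprS; field.
have [] := bfn_monotone_sup hrho mu ndu (B := 8 * C * n).
  move=> m; apply: (le_trans (ru m)); rewrite lee_fin -mulrA ler_wpM2r//.
    by rewrite mulr_ge0.
  by rewrite gerBl mulr_ge0// exprn_ge0.
move=> h [mh rh uh]; exists h; split=> //.
have dom : {ae leb R, forall x : R, forall j,
    op_dom (averaging (s j)) (fun y => (g y)%:C) x}.
  apply: (ae_foralln (mu := leb R)) => j; by have [] := BC0 _ (s1 j) _ Xg.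
apply: ae_sub (ae_and dom uh) => x [domx uhx].
pose I j : set R := `[x - s j, x + s j]%classic.
pose t j (y : R) : \bar R := (((4 ^+ j)^-1)%:E * ((EFin \o g) \_ (I j)) y)%E.
have mgI j : measurable_fun [set: lebT R] ((EFin \o g) \_ (I j)).
  apply/(measurable_restrictT _ (lmeas_itv _)).
  apply: measurable_funTS; apply/measurable_EFinP; exact: mg.1.
have gI0 j y : (0 <= ((EFin \o g) \_ (I j)) y)%E.
  by rewrite patchE; case: ifP => // _; rewrite lee_fin mg.2.
have t0 j y : (0 <= t j y)%E by rewrite mule_ge0// lee_fin invr_ge0 exprn_ge0.
have mt j : measurable_fun [set: lebT R] (t j).
  exact: measurable_funeM.
have mPg : measurable_fun [set: lebT R]
    (fun y : lebT R => ((1 + (x - (y : R)) ^+ 2)^-1 * g y)%:E).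
  apply/measurable_EFinP.
  exact: (lmeas_kernel_section x (@borel_poisson R) mg.1).
have msum : measurable_fun [set: lebT R]
    (fun y : lebT R => (\sum_(0 <= j <oo) t j y)%E).
  by apply: ge0_emeasurable_sum => // j y _ _; exact: t0.
apply: (@le_trans _ _ (\int[leb R]_y (\sum_(0 <= j <oo) t j y)))%E.
  apply: ge0_le_integral; [exact: measurableT| |exact: mPg|exact: msum|].
  - move=> y _; rewrite lee_fin mulr_ge0 ?mg.2// invr_ge0.
    by rewrite addr_ge0// sqr_ge0.
  - move=> y _; have [j [yj pj]] := poisson_le_dyadic (x - y).
    apply: (@le_trans _ _ (t j y)).
      rewrite /t patchE mem_set/=; first by rewrite lee_fin ler_wpM2r// mg.2.
      move: yj; rewrite /I/= in_itv/= ler_norml -/(s j) => /andP[? ?].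
      by apply/andP; split; lra.
    apply: (le_trans _ (nneseries_lim_ge j.+1 _)) => //.
    by rewrite big_nat_recr//= leeDr// sume_ge0.
have intt j : (\int[leb R]_y t j y)%E = (c j * A j x)%:E.
  rewrite ge0_integralZl; [|exact: measurableT|exact: mgI|by move=> y _; exact: gI0|by rewrite lee_fin invr_ge0 exprn_ge0].
  rewrite -integral_mkcond averaging_real//.
  rewrite -EFinM; congr EFin; rewrite -/(T j) -/(A j x) mulrA; congr (_ * _).
  rewrite /c /s (_ : 4 ^+ j = 2 ^+ j * 2 ^+ j :> R); last first.
    by rewrite -exprMn; congr (_ ^+ _); ring.
  by rewrite exprS exprVn; field; rewrite expf_neq0.
rewrite integral_nneseries// (eq_eseriesr (fun j _ => intt j)).
apply: lime_le.
  by apply: is_cvg_nneseries => j _ _; rewrite lee_fin mulr_ge0//; exact: (mA j).2.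
apply: nearW => m; rewrite sumEFin big_mkord lee_fin; exact: uhx.
Qed.

(** Absolute convergence comes with the bound: wherever the majorant of
[poisson_potential] is valid, c times it dominates the integral of
|k(x - y) f(y)|. *)
Lemma dominated_poisson k (c : R) : measurable_fun [set: R] k ->
  (forall t, `|k t| <= c * (1 + t ^+ 2)^-1) -> dominated K rho k.
Proof.
move=> mk kc; have [C C0 pot] := poisson_potential.
have c0 : 0 <= c.
  by have := kc 0; rewrite expr0n addr0 invr1 mulr1; apply: le_trans.
exists (2 * c * C); first by rewrite !mulr_ge0.
move=> f Xf; have [h [mh hC ah]] := pot f Xf.
have mg := Mplus_normc Xf.1.
exists (fun x => 2 * c * h x); split.
- by apply: MplusZ => //; rewrite mulr_ge0.
- rewrite (bfn_homo hrho) ?mulr_ge0// (EFinM (2 * c) C) -muleA.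
  by rewrite lee_wpmul2l// lee_fin mulr_ge0.
apply: ae_sub ah => x hx.
have [_ mr mi] := Mscalar_realM (K := K)
  (lmeas_kernel_section x mk (lmeas_cst 1)) Xf.1.
rewrite -mulrA; apply: (@cintegral_dominated _ _
  (fun y => c * ((1 + (x - y) ^+ 2)^-1 * Normc.normc (f y)))).
- by move: mr; under eq_fun do rewrite mulr1.
- by move: mi; under eq_fun do rewrite mulr1.
- by apply: lmeasM; [exact: lmeas_cst|exact: (lmeas_kernel_section x (@borel_poisson R) mg.1)].
- move=> y; rewrite normc_realM mulrA ler_wpM2r//; exact: normc_ge0.
- under eq_integral do rewrite EFinM.
  rewrite ge0_integralZl; [|exact: measurableT| | |by rewrite lee_fin].
  + by rewrite EFinM lee_wpmul2l// lee_fin.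
  + by apply/measurable_EFinP; exact: (lmeas_kernel_section x (@borel_poisson R) mg.1).
  + by move=> y _; rewrite lee_fin mulr_ge0 ?normc_ge0// invr_ge0 addr_ge0// sqr_ge0.
Qed.

End Potential.

(** * The kernels of the two operators *)

Section SincHilbert.
Variable R : realType.
Implicit Types t : R.

Definition hilbert_kernel t : R := if 1 <= `|t| then t^-1 else 0.
Definition sinc t : R := sin t / t.

Lemma borel_hilbert_kernel : measurable_fun [set: R] hilbert_kernel.
Proof.
apply: measurable_fun_ifT => //; last exact: (@borel_inv R).
apply: measurable_fun_ler => //; exact: measurableT_comp.
Qed.

Lemma borel_sinc : measurable_fun [set: R] sinc.
Proof.
by apply: measurable_funM; [exact: borel_sin|exact: borel_inv].
Qed.

(** Restricting the domain of integration amounts to extending the kernel by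
zero; the two operators agree in their domains of convergence too. *)
Lemma truncated_hilbertE : truncated_hilbert R = kernel_op hilbert_kernel.
Proof.
have mE x : measurable ([set y | 1 <= `|x - y|] : set (lebT R)).
  have mf : lmeas_fun (fun y : R => `|x - y|).
    apply: lmeas_normr; apply: borel_lmeas; exact: measurable_funB.
  have := (@measurable_fun_ler _ (lebT R) R setT _ _ (@lmeas_cst R 1) mf)
    measurableT [set true] I.
  by rewrite setTI.
have E1 (p : R[i] -> R) f x : (forall a z, p (a%:C * z) = a * p z) ->
    (fun y => p (((x - y)^-1)%:C * f y)) \_ [set y | 1 <= `|x - y|] =
    (fun y => p ((hilbert_kernel (x - y))%:C * f y)).
  move=> pM; apply/funext => y; rewrite patchE /hilbert_kernel pM.
  case: (boolP (1 <= `|x - y|)) => xy; first by rewrite mem_set// pM.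
  rewrite memNset; last exact: (negP xy).
  by rewrite pM mul0r.
congr Operator; apply/funext => f; apply/funext => x.
  have domE (p : R[i] -> R) : (forall a z, p (a%:C * z) = a * p z) ->
      (leb R).-integrable [set y | 1 <= `|x - y|]
        (fun y => (p (((x - y)^-1)%:C * f y))%:E) =
      (leb R).-integrable setT (fun y => (p ((hilbert_kernel (x - y))%:C * f y))%:E).
    move=> pM.
    have iE := integrable_mkcond (mu := leb R)
      (EFin \o (fun y => p (((x - y)^-1)%:C * f y))) (mE x).
    by rewrite restrict_EFin (E1 p f x pM) in iE; apply/idP/idP => /iE.
  by rewrite /cintegrable !domE//; [exact: Im_realM|exact: Re_realM].
congr (_ +i* _); rewrite Rintegral_mkcond E1//; [exact: Re_realM|exact: Im_realM].
Qed.

Lemma sin_le_norm t : `|sin t| <= `|t|.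
Proof.
have pos (s : R) : 0 <= s -> `|sin s| <= s.
  move=> s0; have ds x : x \in `]0, s[ -> is_derive x 1 (@sin R) (cos x).
    by move=> _; exact: is_derive_sin.
  have [|c _] := MVT_segment s0 ds.
    by apply: continuous_subspaceT; exact: continuous_sin.
  rewrite sin0 !subr0 => ->; rewrite normrM (ger0_norm s0).
  by rewrite ler_piMl// cos_max.
have [t0|t0] := leP 0 t; first by rewrite (ger0_norm t0) pos.
rewrite -[sin t]opprK -sinN normrN (ltr0_norm t0) pos//.
by rewrite oppr_ge0 ltW.
Qed.

Lemma sinc_le1 t : `|sinc t| <= 1.
Proof.
rewrite /sinc normrM normfV; have [->|t0] := eqVneq t 0.
  by rewrite normr0 invr0 mulr0.
by rewrite ler_pdivrMr ?normr_gt0// mul1r sin_le_norm.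
Qed.

(** The difference vanishes for |t| >= 1 and is sinc t, of modulus at most 1,
elsewhere. *)
Lemma sinc_sub_hilbert t :
  `|sinc t - sin t * hilbert_kernel t| <= 2 * (1 + t ^+ 2)^-1.
Proof.
have p0 : 0 < 1 + t ^+ 2 by rewrite ltr_wpDr ?sqr_ge0.
rewrite /hilbert_kernel; case: ifPn => [t1|]; last rewrite -ltNge => t1.
  by rewrite /sinc subrr normr0 mulr_ge0// invr_ge0 ltW.
rewrite mulr0 subr0; apply: (le_trans (sinc_le1 t)).
rewrite ler_pdivlMr// mul1r -[t ^+ 2]real_normK ?num_real//.
have := normr_ge0 t; nra.
Qed.

(** For |t| > 3 the difference equals cos^2 t (1/t - 1/(t + q)) with q = pi/2,
because sin^2 + cos^2 = 1; as 1 <= q < 2 the point t + q stays away from 0 at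
distance at least |t|/3, so the difference is at most 6/t^2. For |t| <= 3 every
term is at most 1. *)
Lemma hilbert_sub_sinc t :
  `|hilbert_kernel t - (sin t * sinc t + cos t * sinc (t + pi / 2))|
     <= 30 * (1 + t ^+ 2)^-1.
Proof.
have p0 : 0 < 1 + t ^+ 2 by rewrite ltr_wpDr ?sqr_ge0.
rewrite ler_pdivlMr//.
have pi1 := @pihalf_ge1 R; have pi2 := @pihalf_lt2 R.
have sq := sinDpihalf t.
move: pi1 pi2 sq; set q := pi / 2; clearbody q => pi1 pi2 sq.
have [t3|t3] := leP `|t| 3.
  have h1 : `|hilbert_kernel t| <= 1.
    rewrite /hilbert_kernel; case: ifP => [t1|_]; last by rewrite normr0.
    by rewrite normfV invf_le1// (lt_le_trans _ t1).
  have h2 : `|sin t * sinc t + cos t * sinc (t + q)| <= 2.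
    apply: (le_trans (ler_normD _ _)); rewrite (normrM (sin t)) (normrM (cos t)).
    have a1 : `|sin t| * `|sinc t| <= 1.
      by apply: mulr_ile1; rewrite ?sin_max ?sinc_le1.
    have a2 : `|cos t| * `|sinc (t + q)| <= 1.
      by apply: mulr_ile1; rewrite ?cos_max ?sinc_le1.
    by apply: (le_trans (lerD a1 a2)); lra.
  have h3 : `|hilbert_kernel t - (sin t * sinc t + cos t * sinc (t + q))| <= 3.
    apply: (le_trans (ler_normB _ _)); lra.
  have t9 : t ^+ 2 <= 9.
    rewrite -[t ^+ 2]real_normK ?num_real//; have := normr_ge0 t; nra.
  have := sqr_ge0 t.
  set A := `|_ - _| in h3 *; have A0 : 0 <= A by exact: normr_ge0.
  nra.
have t0 : t != 0 by rewrite -normr_gt0; lra.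
have tq0 : t + q != 0.
  rewrite -normr_gt0; have := lerB_normD t q; rewrite (ger0_norm (x := q)); lra.
rewrite /hilbert_kernel (_ : 1 <= `|t|); last by lra.
rewrite /sinc sq.
have -> : t^-1 - (sin t * (sin t / t) + cos t * (cos t / (t + q))) =
    cos t ^+ 2 * (q / (t * (t + q))).
  transitivity ((cos t ^+ 2 + sin t ^+ 2) / t -
    (sin t * (sin t / t) + cos t * (cos t / (t + q)))).
    by rewrite cos2Dsin2 mul1r.
  by field; rewrite t0 tq0.
have q0 : 0 <= q by lra.
have tq : `|t| / 3 <= `|t + q|.
  have := lerB_normD t q; rewrite (ger0_norm q0); lra.
have c1 : `|cos t ^+ 2| <= 1 by rewrite normrX exprn_ile1// cos_max.
have k1 : `|q / (t * (t + q))| <= 6 / t ^+ 2.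
  rewrite normrM normfV normrM (ger0_norm q0).
  apply: (@le_trans _ _ (2 / (`|t| * (`|t| / 3)))).
    apply: ler_pM; [exact: q0|by rewrite invr_ge0 mulr_ge0|lra|].
    by rewrite lef_pV2 ?posrE ?mulr_gt0 ?normr_gt0 ?ler_wpM2l// divr_gt0 ?normr_gt0.
  rewrite -[t ^+ 2]real_normK ?num_real// le_eqVlt; apply/orP; left; apply/eqP.
  by field; rewrite normr_eq0.
have t2 : 9 <= t ^+ 2.
  rewrite -[t ^+ 2]real_normK ?num_real//; nra.
rewrite normrM; apply: (@le_trans _ _ (1 * (6 / t ^+ 2) * (1 + t ^+ 2))).
  by apply: (ler_wpM2r (ltW p0)); apply: ler_pM.
rewrite mul1r mulrAC ler_pdivrMr; nra.
Qed.

End SincHilbert.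

Theorem theorem3p6 (R : realType) (K : scalars) (rho : (R -> R) -> \bar R)
  (hrho : banach_function_norm rho)
  (hT : forall k : R, bounded_on K rho (translation k))
  (hB : uniformly_bounded_on K rho [set s : R | 1 < s] (@averaging R)) :
  bounded_on K rho (truncated_hilbert R) <->
  bounded_on K rho (segment_multiplier R).
Proof.
rewrite truncated_hilbertE -[segment_multiplier R]/(kernel_op (@sinc R)).
have mH := @borel_hilbert_kernel R; have mS := @borel_sinc R.
have msin := @borel_sin R; have mcos := @borel_cos R.
split=> /bounded_kernel_opP H; apply/bounded_kernel_opP => //.
- rewrite (_ : @sinc R = fun t => sin t * hilbert_kernel t +
    (sinc t - sin t * hilbert_kernel t)); last first.
    by apply/funext => t; ring.
  apply: dominatedD => //; first by apply: dominated_sinM => //; exact: H.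
  apply: (dominated_poisson hrho hB _ (@sinc_sub_hilbert R)).
  by apply: measurable_funB => //; exact: measurable_funM.
- rewrite (_ : @hilbert_kernel R = fun t =>
    (sin t * sinc t + cos t * sinc (t + pi / 2)) +
    (hilbert_kernel t - (sin t * sinc t + cos t * sinc (t + pi / 2)))); last first.
    by apply/funext => t; ring.
  apply: dominatedD => //.
    apply: dominatedD => //; first by apply: dominated_sinM => //; exact: H.
    apply: (dominated_cosM hrho (k := fun t => sinc (t + pi / 2))).
    by apply: dominated_shift => //; exact: H.
  apply: (dominated_poisson hrho hB _ (@hilbert_sub_sinc R)).
  apply: measurable_funB => //; apply: measurable_funD; apply: measurable_funM => //.
  apply: (measurableT_comp mS); exact: measurable_funD.
Qed.
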